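(* Let $P$ be a lower semicomputable discrete semimeasure and let $(P_s)_{s\in\mathbb N}$ be a computable approximation of $P$ from below. Let $m(\cdot\mid\cdot)$ be a universal lower semicomputable conditional semimeasure with a computable approximation $(m_t(\cdot\mid\cdot))_{t\in\mathbb N}$ from below. For every total computable function $h$ (mapping a string $x$ and a number $s$ to a number $h(x,s)$) define \[ u_h(x)=\inf_{s}\left\{\frac{m_{h(x,s)}(x\mid s)}{P_s(x)}\right\}. \] Then for every total computable $h$, $u_h$ is an upper semicomputable sumtest for $P$. Moreover, for every upper semicomputable sumtest $e$ for $P$ there exist a constant $c$ and a total computable $h$ such that $e(x)\le c\cdot u_h(x)$ for all strings $x$.
   Context: A (discrete) semimeasure is a function $P$ from finite binary strings to non-negative reals with $\sum_x P(x)\le 1$; it is lower semicomputable if there is a computable family $P_s(x)$ of non-negative rationals, nondecreasing in $s$, with $\lim_s P_s(x)=P(x)$ (an approximation from below). A sumtest for $P$ is a function $f$ from strings to non-negative reals with $\sum_x P(x)f(x)\le 1$; it is upper semicomputable if it is the limit of a computable family of rationals nonincreasing in the stage. A conditional semimeasure is a function $Q(x\mid s)$ (with $s$ a natural number, identified with a string) such that $\sum_x Q(x\mid s)\le 1$ for each $s$; $m(\cdot\mid\cdot)$ is universal if it is lower semicomputable and for every lower semicomputable conditional semimeasure $Q$ there is $c>0$ with $Q(x\mid s)\le c\, m(x\mid s)$ for all $x,s$. A ratio with denominator $0$ is interpreted as $+\infty$.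
   Formalization: The ''moreover'' part assumes also that P_s(x)=0 for all x beyond a computable bound b(s); without this it is false (e.g. P_s=P computable and positive). Sumtests may take the value +∞, as u_h does where P(x)=0. *)

(* Defs.v *)
(* MathComp + MathComp-Analysis. *)
From HB Require Import structures.
From mathcomp Require Import all_boot all_order all_algebra.
From mathcomp Require Import all_classical all_reals all_analysis.
Import Order.TTheory GRing.Theory Num.Theory.
Import numFieldNormedType.Exports.

Set Implicit Arguments.
Unset Strict Implicit.
Unset Printing Implicit Defensive.

Local Open Scope classical_set_scope.
Local Open Scope ring_scope.

(* The total recursive functions in the sense of Goedel and Kleene.
   Minimization is regular: the hypothesis of [rec_min] asserts that the search
   succeeds for every [v].  Every constructor is stated through defining
   equations, so the class is closed under extensional equality. *)
Inductive recursive : forall k : nat, (k.-tuple nat -> nat) -> Prop :=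
| rec_zero k (f : k.-tuple nat -> nat) :
    (forall v, f v = 0%N) -> recursive f
| rec_succ (f : 1.-tuple nat -> nat) :
    (forall v, f v = (thead v).+1) -> recursive f
| rec_proj k (i : 'I_k) (f : k.-tuple nat -> nat) :
    (forall v, f v = tnth v i) -> recursive f
| rec_comp k l (g : l.-tuple nat -> nat) (h : 'I_l -> k.-tuple nat -> nat)
    (f : k.-tuple nat -> nat) :
    recursive g -> (forall i, recursive (h i)) ->
    (forall v, f v = g [tuple h i v | i < l]) -> recursive f
| rec_prim k (g : k.-tuple nat -> nat) (h : k.+2.-tuple nat -> nat)
    (f : k.+1.-tuple nat -> nat) :
    recursive g -> recursive h ->
    (forall v : k.-tuple nat, f [tuple of 0%N :: v] = g v) ->
    (forall y (v : k.-tuple nat), f [tuple of y.+1 :: v] =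
                 h [tuple of y :: f [tuple of y :: v] :: v]) ->
    recursive f
| rec_min k (g : k.+1.-tuple nat -> nat) (f : k.-tuple nat -> nat) :
    recursive g ->
    (forall v : k.-tuple nat, g [tuple of f v :: v] = 0%N /\
               forall y, (y < f v)%N -> g [tuple of y :: v] <> 0%N) ->
    recursive f.

Notation bitstring := (seq bool).

(* Rank in the length-lexicographic order: a bijection between strings and
   natural numbers. *)
Definition strcode (x : bitstring) : nat :=
  foldl (fun (n : nat) (b : bool) => (n.*2 + b.+1)%N) 0%N x.

(* [code1] and [code2] present a string [x], resp. a pair [(x, s)] of a string
   and a condition, as arguments of a recursive function. *)
Definition code1 (x : bitstring) : 1.-tuple nat := [tuple strcode x].

Definition code2 (xs : bitstring * nat) : 2.-tuple nat :=
  [tuple strcode xs.1; xs.2].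

Definition computable_family (X : Type) (k : nat) (enc : X -> k.-tuple nat)
    (F : nat -> X -> nat) : Prop :=
  exists2 r : k.+1.-tuple nat -> nat,
    recursive r & forall s x, F s x = r [tuple of s :: enc x].

Definition computable_nnrat_family (X : Type) (k : nat)
    (enc : X -> k.-tuple nat) (F : nat -> X -> rat) : Prop :=
  exists num den : nat -> X -> nat,
    [/\ computable_family enc num, computable_family enc den
      & forall s x, F s x = (num s x)%:R / (den s x).+1%:R].

Definition approx_below (R : realType) (X : Type) (k : nat)
    (enc : X -> k.-tuple nat) (f : X -> R) (F : nat -> X -> rat) : Prop :=
  [/\ computable_nnrat_family enc F,
      forall s x, F s x <= F s.+1 x
    & forall x, ratr (F s x) @[s --> \oo] --> f x].

Definition lower_semicomputable (R : realType) (X : Type) (k : nat)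
    (enc : X -> k.-tuple nat) (f : X -> R) : Prop :=
  exists F : nat -> X -> rat, approx_below enc f F.

Definition eratio (R : realType) (a b : R) : \bar R :=
  if b == 0 then +oo%E else (a / b)%:E.

(* The approximating family takes values in the non-negative rationals together
   with [+oo], the latter being a fraction with denominator 0.  For a
   real-valued [f] the value [+oo] can be dispensed with, by starting the
   approximation of [f x] at its first finite stage. *)
Definition upper_semicomputable (R : realType) (f : bitstring -> \bar R) :
    Prop :=
  exists num den : nat -> bitstring -> nat,
    let F s x := eratio ((num s x)%:R : R) (den s x)%:R in
    [/\ computable_family code1 num, computable_family code1 den,
        forall s x, (F s.+1 x <= F s x)%E
      & forall x, F s x @[s --> \oo] --> f x].

Definition semimeasure (R : realType) (P : bitstring -> R) : Prop :=
  (forall x, 0 <= P x) /\ (\esum_(x in [set: bitstring]) (P x)%:E <= 1)%E.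

(* [Q (x, s)] stands for Q(x | s). *)
Definition cond_semimeasure (R : realType) (Q : bitstring * nat -> R) : Prop :=
  forall s, semimeasure (fun x => Q (x, s)).

Definition universal (R : realType) (m : bitstring * nat -> R) : Prop :=
  [/\ cond_semimeasure m, lower_semicomputable code2 m
    & forall Q : bitstring * nat -> R,
        cond_semimeasure Q -> lower_semicomputable code2 Q ->
        exists2 c : R, 0 < c & forall x s, Q (x, s) <= c * m (x, s)].

(* Values are extended because [u_fun] below is [+oo] where [P] vanishes; there
   the product is [0 * +oo = 0]. *)
Definition sumtest (R : realType) (P : bitstring -> R) (f : bitstring -> \bar R)
    : Prop :=
  (forall x, 0 <= f x)%E /\
  (\esum_(x in [set: bitstring]) ((P x)%:E * f x) <= 1)%E.

Definition u_fun (R : realType) (Ps : nat -> bitstring -> rat)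
    (mt : nat -> bitstring * nat -> rat) (h : bitstring -> nat -> nat)
    (x : bitstring) : \bar R :=
  ereal_inf (range (fun s : nat =>
    eratio (ratr (mt (h x s) (x, s)) : R) (ratr (Ps s x)))).

(* Without this property domination by the functions [u_fun] can fail: for a
   computable positive [P] and [Ps s = P] for all [s], it would yield a
   computable semimeasure above [x |-> P x * e x] up to a constant, and a
   diagonalization produces an upper semicomputable sumtest [e] for which there
   is none. *)
Definition computably_finite_support (Ps : nat -> bitstring -> rat) : Prop :=
  exists2 b : 1.-tuple nat -> nat, recursive b &
    forall s x, (b [tuple s] <= strcode x)%N -> Ps s x = 0.

(* Main.v *)
(* For each stage s, P_s(x) u_h(x) <= m(x | s), so these products sum to at most
   1; letting s grow shows that u_h is a sumtest.

   Conversely, P_s has finite support and sum_x P_s(x) e(x) <= 1, so a stage t of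
   the approximation of e with sum_x P_s(x) e_t(x) <= 2 can be found effectively
   from s.  Then Q(x | s) = P_s(x) e_t(x) / 2 is a computable conditional
   semimeasure.  It is dominated by m, and for a large enough constant c it is
   even bounded by c m_t'(x | s) for some stage t'; the first such t' is
   h(x, s). *)
Require Import Defs.
From mathcomp Require Import all_boot all_order all_algebra.
From mathcomp Require Import all_classical all_reals all_analysis.
From mathcomp Require Import ring.
Import Order.TTheory GRing.Theory Num.Theory.
Import numFieldNormedType.Exports.
Local Open Scope classical_set_scope.
Local Open Scope ring_scope.
Set Implicit Arguments.
Unset Strict Implicit.
Unset Printing Implicit Defensive.

(* Arguments as plain lists, so that binding an argument is consing it. *)
Definition recfun (k : nat) (F : seq nat -> nat) : Prop :=
  recursive (fun v : k.-tuple nat => F v).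

(** * Closure properties of the recursive functions *)

Section RecursiveFunctions.
Local Open Scope nat_scope.
Implicit Types (k l : nat) (F G : seq nat -> nat).

Lemma recfun_nth k i : i < k -> recfun k (fun v => nth 0 v i).
Proof. by move=> ik; apply: (@rec_proj _ (Ordinal ik)) => v; rewrite (tnth_nth 0). Qed.

(** Only lists of length [k] matter, so [t] needs the right length on these alone; the entries of
    [t v] are the inner functions of [rec_comp]. *)
Lemma recfun_comp k l (t : seq nat -> seq nat) F :
  recfun l F -> (forall v, size v = k -> size (t v) = l) ->
  (forall i, i < l -> recfun k (fun v => nth 0 (t v) i)) ->
  recfun k (fun v => F (t v)).
Proof.
move=> rF st rt.
apply: (@rec_comp _ _ _ (fun (i : 'I_l) (v : k.-tuple nat) => nth 0 (t v) i) _ rF).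
  by move=> i; apply: rt.
move=> v; congr F; apply: (@eq_from_nth _ 0); first by rewrite st !size_tuple.
move=> i; rewrite st ?size_tuple // => il.
by have := tnth_mktuple (fun j : 'I_l => nth 0 (t v) j) (Ordinal il); rewrite (tnth_nth 0).
Qed.

Lemma recfun_comp1 k F a : recfun 1 F -> recfun k a ->
  recfun k (fun v => F [:: a v]).
Proof. by move=> rF ra; apply: (@recfun_comp k 1 (fun v => [:: a v])) => // -[]. Qed.

Lemma recfun_comp2 k F a b : recfun 2 F -> recfun k a -> recfun k b ->
  recfun k (fun v => F [:: a v; b v]).
Proof.
by move=> rF ra rb; apply: (@recfun_comp k 2 (fun v => [:: a v; b v])) => // -[|[]].
Qed.

Lemma recfun_comp3 k F a b c :
  recfun 3 F -> recfun k a -> recfun k b -> recfun k c ->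
  recfun k (fun v => F [:: a v; b v; c v]).
Proof.
move=> rF ra rb rc.
by apply: (@recfun_comp k 3 (fun v => [:: a v; b v; c v])) => // -[|[|[]]].
Qed.

(** The step function of a primitive recursion receives the counter, the previous value and then the
    parameters. This lemma gives access to the parameters alone, the next one to the counter with
    the parameters. *)
Lemma recfun_behead2 k F : recfun k F ->
  recfun k.+2 (fun v => F (behead (behead v))).
Proof.
move=> rF; apply: (@recfun_comp k.+2 k (fun v => behead (behead v))) => //.
  by move=> v sv; rewrite !size_behead sv.
move=> i ik; under eq_fun do rewrite !nth_behead.
exact: recfun_nth.
Qed.

Lemma recfun_drop1 k F : recfun k.+1 F ->
  recfun k.+2 (fun v => F (nth 0 v 0 :: behead (behead v))).
Proof.
move=> rF; apply: (@recfun_comp k.+2 k.+1 (fun v => nth 0 v 0 :: behead (behead v))) => //.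
  by move=> v sv /=; rewrite !size_behead sv.
case=> [|i] ik /=; first exact: recfun_nth.
under eq_fun do rewrite !nth_behead.
exact: recfun_nth.
Qed.

Lemma recfun_succ k a : recfun k a -> recfun k (fun v => (a v).+1).
Proof.
move=> ra; apply: (@recfun_comp1 k (fun v => (nth 0 v 0).+1)) => //.
by apply: rec_succ => v; rewrite /thead (tnth_nth 0).
Qed.

Lemma recfun_const k c : recfun k (fun=> c).
Proof. by elim: c => [|c /recfun_succ//]; apply: rec_zero. Qed.

Lemma recfun_primrec k (f : nat -> seq nat -> nat) G H :
  recfun k G -> recfun k.+2 H ->
  (forall v, f 0 v = G v) ->
  (forall y v, f y.+1 v = H [:: y, f y v & v]) ->
  recfun k.+1 (fun v => f (nth 0 v 0) (behead v)).
Proof. by move=> rG rH f0 fS; apply: (rec_prim rG rH) => [v|y v] /=. Qed.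

(** Evaluates a function built by recursion on its first argument at a computed bound. *)
Lemma recfun_bind k F b : recfun k.+1 F -> recfun k b ->
  recfun k (fun v => F (b v :: v)).
Proof.
move=> rF rb; apply: (@recfun_comp k k.+1 (fun v => b v :: v)) => //.
  by move=> v /= ->.
by case=> [|i] ik //=; apply: recfun_nth.
Qed.

Lemma recfun_add k a b : recfun k a -> recfun k b ->
  recfun k (fun v => a v + b v).
Proof.
move=> ra rb.
have r : recfun k.+1 (fun v => a (behead v) + nth 0 v 0).
  apply: (@recfun_primrec k (fun n v => a v + n) a (fun v => (nth 0 v 1).+1)) => //.
  - by apply/recfun_succ/recfun_nth.
  - by move=> v; rewrite addn0.
  - by move=> y v; rewrite addnS.
exact: recfun_bind r rb.
Qed.

Lemma recfun_mul k a b : recfun k a -> recfun k b ->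
  recfun k (fun v => a v * b v).
Proof.
move=> ra rb.
have r : recfun k.+1 (fun v => a (behead v) * nth 0 v 0).
  apply: (@recfun_primrec k (fun n v => a v * n) (fun=> 0)
    (fun v => a (behead (behead v)) + nth 0 v 1)) => //.
  - exact: recfun_const.
  - by apply: recfun_add; [exact: recfun_behead2|exact: recfun_nth].
  - by move=> v; rewrite muln0.
  - by move=> y v; rewrite mulnS.
exact: recfun_bind r rb.
Qed.

Lemma recfun_pred k a : recfun k a -> recfun k (fun v => (a v).-1).
Proof.
move=> ra.
have r : recfun k.+1 (fun v => (nth 0 v 0).-1).
  apply: (@recfun_primrec k (fun n v => n.-1) (fun=> 0) (fun v => nth 0 v 0)) => //.
  - exact: recfun_const.
  - exact: recfun_nth.
exact: recfun_bind r ra.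
Qed.

Lemma recfun_sub k a b : recfun k a -> recfun k b ->
  recfun k (fun v => a v - b v).
Proof.
move=> ra rb.
have r : recfun k.+1 (fun v => a (behead v) - nth 0 v 0).
  apply: (@recfun_primrec k (fun n v => a v - n) a (fun v => (nth 0 v 1).-1)) => //.
  - by apply/recfun_pred/recfun_nth.
  - by move=> v; rewrite subn0.
  - by move=> y v; rewrite subnS.
exact: recfun_bind r rb.
Qed.

(** Predicates are treated as functions into 0 and 1 through the coercion from [bool] to [nat]. *)
Lemma recfun_eq0 k a : recfun k a -> recfun k (fun v => a v == 0).
Proof.
move=> ra.
have r : recfun k.+1 (fun v => nth 0 v 0 == 0).
  by apply: (@recfun_primrec k (fun n v => n == 0) (fun=> 1) (fun=> 0)) => //;
    exact: recfun_const.
exact: recfun_bind r ra.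
Qed.

Lemma recfun_leq k a b : recfun k a -> recfun k b -> recfun k (fun v => a v <= b v).
Proof. by move=> ra rb; apply: recfun_eq0; apply: recfun_sub. Qed.

Lemma recfun_if k (c : seq nat -> bool) a b :
  recfun k c -> recfun k a -> recfun k b ->
  recfun k (fun v => if c v then a v else b v).
Proof.
move=> rc ra rb.
have -> : (fun v => if c v then a v else b v) =
    (fun v => c v * a v + (1 - c v) * b v).
  by apply/funext => v; case: (c v); rewrite ?mul1n ?mul0n ?addn0.
apply: recfun_add; apply: recfun_mul => //.
by apply: recfun_sub => //; apply: recfun_const.
Qed.

(** Unbounded search for the least witness. Since [rec_min] searches for a zero, it is applied to
    [1 - c]. *)
Lemma recfun_min k (c : seq nat -> bool) :
  recfun k.+1 c -> (forall v, exists y, c (y :: v)) ->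
  exists2 f, recfun k f & forall v, c (f v :: v).
Proof.
move=> rc exc; pose f v := ex_minn (exc v); exists f; last first.
  by move=> v; rewrite /f; case: ex_minnP.
have rnc : recfun k.+1 (fun v => 1 - c v).
  by apply: recfun_sub => //; apply: recfun_const.
apply: (rec_min rnc) => v; rewrite /f; case: ex_minnP => n /= cn nmin.
rewrite cn; split=> // y yn /=; case: (boolP (c _)) => // /nmin.
by rewrite leqNgt yn.
Qed.

End RecursiveFunctions.

(** * Computable non-negative rationals and exact arithmetic on them *)

Definition recrat (k : nat) (F : seq nat -> rat) : Prop :=
  exists num den : seq nat -> nat,
    [/\ recfun k num, recfun k den
      & forall v, F v = (num v)%:R / (den v).+1%:R].

Section RecursiveRationals.
Implicit Types (k : nat) (F G : seq nat -> rat).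

Lemma recrat_nat k a : recfun k a -> recrat k (fun v => (a v)%:R).
Proof.
move=> ra; exists a, (fun=> 0%N); split=> //; first exact: recfun_const.
by move=> v; rewrite divr1.
Qed.

Lemma recrat_const k (c : nat) : recrat k (fun=> c%:R).
Proof. exact/recrat_nat/recfun_const. Qed.

Lemma recrat_mul k F G : recrat k F -> recrat k G ->
  recrat k (fun v => F v * G v).
Proof.
move=> [n1 [d1 [rn1 rd1 F_]]] [n2 [d2 [rn2 rd2 G_]]].
exists (fun v => n1 v * n2 v)%N, (fun v => ((d1 v).+1 * (d2 v).+1).-1)%N; split.
- exact: recfun_mul.
- by apply: recfun_pred; apply: recfun_mul; apply: recfun_succ.
- by move=> v; rewrite F_ G_ prednK // mulf_div !natrM.
Qed.

Lemma recrat_inv k F : recrat k F -> recrat k (fun v => (F v)^-1).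
Proof.
move=> [n [d [rn rd F_]]].
(* The inverse of 0 is 0, so a zero numerator needs its own case; otherwise the predecessor
   compensates the shift of denominators by one. *)
exists (fun v => if n v == 0 then 0 else (d v).+1)%N, (fun v => (n v).-1); split.
- apply: recfun_if; [exact: recfun_eq0|exact: recfun_const|exact: recfun_succ].
- exact: recfun_pred.
- move=> v; rewrite F_; case: (n v) => [|m] /=; first by rewrite !mul0r invr0.
  by rewrite invf_div.
Qed.

Lemma recrat_if k (c : seq nat -> bool) F G :
  recfun k c -> recrat k F -> recrat k G ->
  recrat k (fun v => if c v then F v else G v).
Proof.
move=> rc [n1 [d1 [rn1 rd1 F_]]] [n2 [d2 [rn2 rd2 G_]]].
exists (fun v => if c v then n1 v else n2 v), (fun v => if c v then d1 v else d2 v).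
split; [exact: recfun_if|exact: recfun_if|].
by move=> v; case: (c v).
Qed.

Lemma recfun_le k F G : recrat k F -> recrat k G ->
  recfun k (fun v => F v <= G v).
Proof.
move=> [n1 [d1 [rn1 rd1 F_]]] [n2 [d2 [rn2 rd2 G_]]].
under eq_fun => v.
  rewrite F_ G_ ler_pdivrMr ?ltr0n // mulrAC ler_pdivlMr ?ltr0n //.
  rewrite -!natrM ler_nat.
  over.
by apply: recfun_leq; apply: recfun_mul => //; apply: recfun_succ.
Qed.

Lemma recrat_comp2 k F a b : recrat 2 F -> recfun k a -> recfun k b ->
  recrat k (fun v => F [:: a v; b v]).
Proof.
move=> [n [d [rn rd F_]]] ra rb.
exists (fun v => n [:: a v; b v]), (fun v => d [:: a v; b v]).
by split=> //; apply: recfun_comp2.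
Qed.

Lemma recrat_comp3 k F a b c :
  recrat 3 F -> recfun k a -> recfun k b -> recfun k c ->
  recrat k (fun v => F [:: a v; b v; c v]).
Proof.
move=> [n [d [rn rd F_]]] ra rb rc.
exists (fun v => n [:: a v; b v; c v]), (fun v => d [:: a v; b v; c v]).
by split=> //; apply: recfun_comp3.
Qed.

Lemma recrat_sum k F b : recrat k.+1 F -> recfun k b ->
  recrat k (fun v => \sum_(i < b v) F (val i :: v)).
Proof.
move=> [n [d [rn rd F_]]] rb.
(* [D m v] is a common denominator of the first [m] summands and [N m v] the numerator of their sum
   over it; both are primitive recursive in [m]. *)
pose D m v := (\prod_(i < m) (d (val i :: v)).+1)%N.
pose N := fix N m v := if m is p.+1 then
  (N p v * (d (p :: v)).+1 + n (p :: v) * D p v)%N else 0%N.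
have rD : recfun k.+1 (fun v => D (nth 0%N v 0) (behead v)).
  apply: (@recfun_primrec k D (fun=> 1%N)
    (fun v => nth 0 v 1 * (d (nth 0 v 0 :: behead (behead v))).+1)%N).
  - exact: recfun_const.
  - by apply: recfun_mul; [exact: recfun_nth|exact/recfun_succ/recfun_drop1].
  - by move=> v; rewrite /D big_ord0.
  - by move=> y v; rewrite /D big_ord_recr.
have rN : recfun k.+1 (fun v => N (nth 0%N v 0) (behead v)).
  apply: (@recfun_primrec k N (fun=> 0%N)
    (fun v => nth 0 v 1 * (d (nth 0 v 0 :: behead (behead v))).+1 +
      n (nth 0 v 0 :: behead (behead v)) * D (nth 0 v 0) (behead (behead v)))%N) => //.
  - exact: recfun_const.
  - apply: recfun_add; apply: recfun_mul.
    + exact: recfun_nth.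
    + exact/recfun_succ/recfun_drop1.
    + exact: recfun_drop1.
    + exact: recfun_drop1 rD.
exists (fun v => N (b v) v), (fun v => (D (b v) v).-1); split.
- exact: recfun_bind rN rb.
- by apply: recfun_pred; exact: recfun_bind rD rb.
- move=> v; have D_gt0 m : (0 < D m v)%N by rewrite prodn_gt0.
  rewrite prednK //; elim: (b v) => [|m IH]; first by rewrite big_ord0 mul0r.
  rewrite big_ord_recr /= IH F_ addf_div ?pnatr_eq0 -?lt0n //.
  by rewrite natrD !natrM {4}/D big_ord_recr /= natrM.
Qed.

End RecursiveRationals.

(** * Strings as natural numbers, and sums over strings *)

Section Strings.

Lemma strcode_rcons x b : strcode (rcons x b) = ((strcode x).*2 + b.+1)%N.
Proof. by rewrite /strcode -cats1 foldl_cat. Qed.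

(** The parity of the rank minus one gives the last bit, and halving gives the rank of the rest. *)
Lemma strcode_inj : injective strcode.
Proof.
elim/last_ind => [|x b IH] y.
  by case/lastP: y => // y b; rewrite strcode_rcons addnS.
case/lastP: y => [|y c]; rewrite !strcode_rcons ?addnS // => -[bc].
have odd_code (n : nat) (d : bool) : odd (n.*2 + d) = d.
  by rewrite oddD odd_double oddb.
have ebc : b = c by rewrite -[b](odd_code (strcode x)) -[c](odd_code (strcode y)) bc.
by move: bc; rewrite ebc => /addIn/double_inj/IH ->.
Qed.

Lemma strcode_surj n : exists x, strcode x = n.
Proof.
elim/ltn_ind: n => -[|n] IH; first by exists [::].
have [x xn] : exists x, strcode x = n./2 
  by apply: IH; rewrite ltnS -[leqRHS]odd_double_half -addnn addnA leq_addl.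
by exists (rcons x (odd n)); rewrite strcode_rcons xn addnS addnC odd_double_half.
Qed.

(** The inverse is chosen rather than computed: the recursive functions act on ranks, and
    [strdecode] serves only to reason about them. *)
Definition strdecode (n : nat) : bitstring := xget [::] [set x | strcode x = n].

Lemma strdecodeK : cancel strdecode strcode.
Proof.
move=> n; rewrite /strdecode; case: xgetP => [x -> //|no].
by have [x /no] := strcode_surj n.
Qed.

Lemma strcodeK : cancel strcode strdecode.
Proof. by move=> x; apply: strcode_inj; rewrite strdecodeK. Qed.

(** Reduces bounds on infinite sums to finite partial sums in order of rank, through which limits in
    the stage can be taken term by term. *)
Lemma esum_strings_leP (R : realType) (f : bitstring -> \bar R) (c : \bar R) :
  (forall x, 0 <= f x)%E ->
  (\esum_(x in [set: bitstring]) f x <= c)%E <->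
  forall n, (\sum_(i < n) f (strdecode i) <= c)%E.
Proof.
move=> f0.
have decode_bij : set_bij [set: nat] [set: bitstring] strdecode.
  by rewrite setTT_bijective; exists strcode; [exact: strdecodeK|exact: strcodeK].
rewrite (reindex_esum _ _ _ _ decode_bij) -nneseries_esumT //; split=> [fc n|fc].
  apply: le_trans fc; rewrite -(big_mkord xpredT (fun i => f (strdecode i))).
  exact: nneseries_lim_ge.
apply: lime_le; first exact: is_cvg_nneseries.
by apply: nearW => n; rewrite big_mkord.
Qed.

End Strings.

(** A function on tuples extends to all lists by reading the first [k] entries, with 0 for missing
    ones. *)
Lemma recursive_recfun k (r : k.-tuple nat -> nat) : recursive r ->
  exists2 f, recfun k f & forall v, r v = f v.
Proof.
move=> rr; have K (v : k.-tuple nat) : [tuple nth 0%N v i | i < k] = v.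
  by apply: eq_from_tnth => i; rewrite tnth_mktuple (tnth_nth 0%N).
exists (fun v => r [tuple nth 0%N v i | i < k]) => [|v]; last by rewrite K.
by rewrite /recfun; under eq_fun do rewrite K.
Qed.

Lemma computable_familyP X k (enc : X -> k.-tuple nat) F :
  computable_family enc F <->
  exists2 f, recfun k.+1 f & forall s x, F s x = f (s :: enc x).
Proof.
split=> [[r /recursive_recfun[f rf fE] FE]|[f rf FE]].
  by exists f => // s x; rewrite FE fE.
by exists (fun v => f v).
Qed.

Lemma computable_nnrat_familyP X k (enc : X -> k.-tuple nat) F :
  computable_nnrat_family enc F <->
  exists2 f, recrat k.+1 f & forall s x, F s x = f (s :: enc x).
Proof.
split=> [[n [d [/computable_familyP[n' rn nE] /computable_familyP[d' rd dE] FE]]]|].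
  exists (fun v => (n' v)%:R / (d' v).+1%:R); first by exists n', d'.
  by move=> s x; rewrite FE nE dE.
move=> [f [n [d [rn rd fE]]] FE].
exists (fun s x => n (s :: enc x)), (fun s x => d (s :: enc x)).
split; last by move=> s x; rewrite FE fE.
- by apply/computable_familyP; exists n.
- by apply/computable_familyP; exists d.
Qed.

(** * Infima of computable sequences of ratios *)

Section UpperSemicomputable.
Variable R : realType.

Lemma eratio_natE (a b : nat) : (0 < b)%N ->
  eratio (a%:R : R) b%:R = (a%:R / b%:R)%:E.
Proof. by rewrite /eratio pnatr_eq0 lt0n => /negPf ->. Qed.

(** Cross-multiplication remains correct for the value [+oo] as long as the left fraction is not
    0/0, for which the right-hand side would always be true. *)
Lemma eratio_nat_le (a b c d : nat) : (b = 0 -> 0 < a)%N ->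
  (eratio (a%:R : R) b%:R <= eratio (c%:R : R) d%:R)%E = (a * d <= c * b)%N.
Proof.
case: d => [|d]; first by rewrite /eratio eqxx leey muln0.
case: b => [/(_ erefl)|b _].
  by rewrite muln0 leqn0 muln_eq0 orbF lt0n /eratio eqxx pnatr_eq0 => /negPf ->.
rewrite !eratio_natE // lee_fin ler_pdivrMr ?ltr0n // mulrAC ler_pdivlMr ?ltr0n //.
by rewrite -!natrM ler_nat.
Qed.

(** The running minima of the ratios are computable and nonincreasing, and they converge to the
    infimum. *)
Lemma inf_upper_semicomputable (N D : seq nat -> nat) :
  recfun 2 N -> recfun 2 D -> (forall v, D v = 0 -> 0 < N v)%N ->
  upper_semicomputable (fun x => ereal_inf (range (fun s =>
    eratio ((N [:: s; strcode x])%:R : R) (D [:: s; strcode x])%:R))).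
Proof.
move=> rN rD N0.
(* [a s] points at the least of the first s + 1 ratios.  Denominator 0 means
   +oo, for which comparison by cross-multiplication is right because the
   numerator is then positive. *)
pose a := fix a s (v : seq nat) := if s is t.+1 then
  (if (N [:: a t v; nth 0 v 0] * D [:: t.+1; nth 0 v 0] <=
       N [:: t.+1; nth 0 v 0] * D [:: a t v; nth 0 v 0])%N
   then a t v else t.+1) else 0%N.
have ra : recfun 2 (fun v => a (nth 0%N v 0) (behead v)).
  apply: (@recfun_primrec 1 a (fun=> 0%N) (fun w =>
    if (N [:: nth 0 w 1; nth 0 w 2] * D [:: (nth 0 w 0).+1; nth 0 w 2] <=
        N [:: (nth 0 w 0).+1; nth 0 w 2] * D [:: nth 0 w 1; nth 0 w 2])%N
    then nth 0 w 1 else (nth 0 w 0).+1)%N) => //.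
  - exact: recfun_const.
  - have rS : recfun 3 (fun w => (nth 0 w 0).+1)%N.
      by apply/recfun_succ/recfun_nth.
    apply: recfun_if => //; last exact: recfun_nth.
    by apply: recfun_leq; apply: recfun_mul;
      apply: recfun_comp2 => //; apply: recfun_nth.
pose q x s : \bar R := eratio (N [:: s; strcode x])%:R (D [:: s; strcode x])%:R.
pose b s x := a s [:: strcode x].
have bS s x : b s.+1 x =
    if (q x (b s x) <= q x s.+1)%E then b s x else s.+1.
  by rewrite /q eratio_nat_le //; apply: N0.
have q_le s x : (q x (b s.+1 x) <= q x (b s x))%E /\ (q x (b s.+1 x) <= q x s.+1)%E.
  rewrite bS; case: ifPn => // nle; split=> //.
  by apply: ltW; rewrite ltNge.
exists (fun s x => N [:: b s x; strcode x]), (fun s x => D [:: b s x; strcode x]).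
split=> [|||x]; last 1 first.
(* Every running minimum is one of the ratios, and every ratio is at least some running minimum. *)
- have -> : ereal_inf (range (q x)) = ereal_inf (range (fun s => q x (b s x))).
    apply/eqP; rewrite eq_le; apply/andP; split; apply/ereal_infP => _ [s _ <-].
      by apply: ereal_inf_lbound; exists (b s x).
    case: s => [|s]; first by apply: ereal_inf_lbound; exists 0%N.
    apply: le_trans (q_le s x).2; apply: ereal_inf_lbound; by exists s.+1.
  apply: ereal_nonincreasing_cvgn; apply/nonincreasing_seqP => s.
  exact: (q_le s x).1.
- apply/computable_familyP.
  exists (fun v => N [:: a (nth 0 v 0) (behead v); nth 0 v 1])%N => //.
  by apply: recfun_comp2 => //; apply: recfun_nth.
- apply/computable_familyP.
  exists (fun v => D [:: a (nth 0 v 0) (behead v); nth 0 v 1])%N => //.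
  by apply: recfun_comp2 => //; apply: recfun_nth.
- by move=> s x; exact: (q_le s x).1.
Qed.

End UpperSemicomputable.

(** * Approximations from below *)

Section Approximations.
Variables (R : realType) (X : Type) (k : nat) (enc : X -> k.-tuple nat).
Variables (f : X -> R) (F : nat -> X -> rat).
Hypothesis fF : approx_below enc f F.

Lemma approx_below_ge0 s x : 0 <= F s x.
Proof. by have [[n [d [_ _ ->]]] _ _] := fF; rewrite divr_ge0. Qed.

Lemma approx_below_le s x : ratr (F s x) <= f x.
Proof.
have [_ F_le F_cvg] := fF.
rewrite -(cvg_lim _ (F_cvg x)) //; apply: nondecreasing_cvgn_le.
  by apply/nondecreasing_seqP => t; rewrite ler_rat.
by apply: cvgP (F_cvg x).
Qed.

Lemma approx_below_gt x c : c < f x -> exists s, c < ratr (F s x).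
Proof.
have [_ _ F_cvg] := fF.
by move=> /(cvgr_gt (f x) (F_cvg x))/filter_ex.
Qed.

Lemma approx_below_lim_ge0 x : 0 <= f x.
Proof. by apply: le_trans (approx_below_le 0 x); rewrite ler0q approx_below_ge0. Qed.

End Approximations.

(** * The functions [u_fun] are upper semicomputable sumtests *)

Section TestFunctions.
Variables (R : realType) (P : bitstring -> R) (Ps : nat -> bitstring -> rat).
Variables (m : bitstring * nat -> R) (mt : nat -> bitstring * nat -> rat).
Hypotheses (hPs : approx_below code1 P Ps) (hmt : approx_below code2 m mt).
Variable h : bitstring -> nat -> nat.

Lemma u_fun_ge0 x : (0 <= u_fun R Ps mt h x)%E.
Proof.
apply/ereal_infP => _ [s _ <-]; rewrite /eratio; case: ifP => // _.
rewrite lee_fin; apply: divr_ge0; rewrite ler0q.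
  exact: approx_below_ge0 hmt _ _.
exact: approx_below_ge0 hPs _ _.
Qed.

Lemma u_fun_le s x : 0 < Ps s x ->
  (u_fun R Ps mt h x <= (ratr (mt (h x s) (x, s)) / ratr (Ps s x))%:E)%E.
Proof.
move=> p0; apply: ereal_inf_lbound; exists s => //.
by rewrite /eratio fmorph_eq0 gt_eqF.
Qed.

(** Where [Ps s x] vanishes the product is 0 even if [u_fun] is [+oo]. Elsewhere the ratio at [s]
    bounds the infimum and [Ps s x] cancels. *)
Lemma mul_u_fun_le s x : ((ratr (Ps s x) : R)%:E * u_fun R Ps mt h x <= (m (x, s))%:E)%E.
Proof.
have := approx_below_ge0 hPs s x; rewrite le_eqVlt => /predU1P[<-|p0].
  by rewrite rmorph0 mul0e lee_fin (approx_below_lim_ge0 hmt).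
have rp0 : 0 < (ratr (Ps s x) : R) by rewrite ltr0q.
apply: (@le_trans _ _ (ratr (mt (h x s) (x, s)))%:E).
  apply: le_trans (lee_wpmul2l _ (u_fun_le p0)) _; first by rewrite lee_fin ltW.
  by rewrite -EFinM mulrCA divff ?mulr1 // gt_eqF.
by rewrite lee_fin (approx_below_le hmt).
Qed.

Lemma u_fun_sumtest : cond_semimeasure m -> sumtest P (u_fun R Ps mt h).
Proof.
move=> hm; split; first exact: u_fun_ge0.
have P_ge0 := approx_below_lim_ge0 hPs.
apply/esum_strings_leP => [x|n].
  by apply: mule_ge0; [rewrite lee_fin|exact: u_fun_ge0].
pose v x s := ((ratr (Ps s x) : R)%:E * u_fun R Ps mt h x)%E.
(* Multiplication is discontinuous at 0 times [+oo]. If [P x = 0], all [Ps s x] vanish and the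
   sequence is constantly 0; if [P x > 0], some [Ps s x] is positive, which makes [u_fun] finite at
   [x]. *)
have v_cvg x : v x s @[s --> \oo] --> ((P x)%:E * u_fun R Ps mt h x)%E.
  have := P_ge0 x; rewrite le_eqVlt => /predU1P[Px0|Px0].
    rewrite -Px0 mul0e (_ : v x = cst 0%E); first exact: cvg_cst.
    apply/funext => s; rewrite /v (_ : ratr _ = 0) ?mul0e //.
    apply/eqP; rewrite eq_le {1}Px0 (approx_below_le hPs) /=.
    by rewrite ler0q (approx_below_ge0 hPs).
  have [s] := approx_below_gt hPs Px0; rewrite ltr0q => /u_fun_le u_le.
  apply: cvgeZr; last by have [_ _ P_cvg] := hPs; apply: cvg_EFin; [exact: nearW|exact: P_cvg].
  by rewrite ge0_fin_numE ?u_fun_ge0 // (le_lt_trans u_le) ?ltry.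
have sum_cvg : (\sum_(i < n) v (strdecode i) s)%E @[s --> \oo] -->
    (\sum_(i < n) (P (strdecode i))%:E * u_fun R Ps mt h (strdecode i))%E.
  apply: cvg_nnesum => i _ //.
  apply: nearW => s; apply: mule_ge0; last exact: u_fun_ge0.
  by rewrite lee_fin ler0q (approx_below_ge0 hPs).
apply: cvge_le sum_cvg; apply: nearW => s.
apply: (@le_trans _ _ (\sum_(i < n) (m (strdecode i, s))%:E)%E).
  by apply: lee_sum => i _; apply: mul_u_fun_le.
have [m0 m1] := hm s.
by move: n; apply/(@esum_strings_leP _ (fun x => (m (x, s))%:E)).
Qed.

Lemma u_fun_upper_semicomputable :
  computable_family code1 (fun s x => h x s) ->
  upper_semicomputable (u_fun R Ps mt h).
Proof.
move=> /computable_familyP[g rg gE].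
have [/computable_nnrat_familyP[p [np [dp [rnp rdp pE]]] PsE] _ _] := hPs.
have [/computable_nnrat_familyP[q [nq [dq [rnq rdq qE]]] mtE] _ _] := hmt.
(* From the stage [s] and the rank of [x], the arguments of [q] giving the value of [mt] at stage
   [h x s] on the pair of [x] and [s]. *)
pose q_args (v : seq nat) := [:: g [:: nth 0 v 0; nth 0 v 1]; nth 0 v 1; nth 0 v 0]%N.
(* The ratio as a single fraction. The summand [D v == 0] in [N] excludes 0/0 without changing the
   value [+oo]. *)
pose D v := (np v * (dq (q_args v)).+1)%N.
pose N v := (nq (q_args v) * (dp v).+1 + (D v == 0))%N.
have r_args F : recfun 3 F -> recfun 2 (fun v => F (q_args v)).
  move=> rF; apply: recfun_comp3 => //; try exact: recfun_nth.
  by apply: recfun_comp2 => //; exact: recfun_nth.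
have rD : recfun 2 D.
  by apply: recfun_mul => //; apply: recfun_succ; exact: (r_args (fun w => dq w)).
have rN : recfun 2 N.
  apply: recfun_add; last exact: recfun_eq0.
  by apply: recfun_mul; [exact: (r_args (fun w => nq w))|exact: recfun_succ].
have -> : u_fun R Ps mt h = fun x => ereal_inf (range (fun s =>
    eratio ((N [:: s; strcode x])%:R : R) (D [:: s; strcode x])%:R)).
  apply/funext => x; congr (ereal_inf _); apply: eq_imagel => s _.
  rewrite PsE mtE pE qE gE /N /D /q_args /=.
  set a := nq _; set b := np _; set c := (dp _).+1; set d := (dq _).+1.
  rewrite /eratio fmorph_eq0 mulf_eq0 invr_eq0 !pnatr_eq0 muln_eq0 !orbF.
  case: eqP => //= b0.
  rewrite addn0 !fmorph_div !rmorph_nat !natrM; congr EFin.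
  by field; rewrite !pnatr_eq0 andbT; apply/andP; split=> //; apply/eqP.
apply: inf_upper_semicomputable => // v D0.
by rewrite /N D0 addn1.
Qed.

End TestFunctions.

(** * Domination of an arbitrary upper semicomputable sumtest *)

Lemma ler_sum_support (A : numDomainType) (f : nat -> A) b n :
  (forall i, 0 <= f i) -> (forall i, (b <= i)%N -> f i = 0) ->
  \sum_(i < n) f i <= \sum_(i < b) f i.
Proof.
move=> f0 fb; have [nb|/ltnW bn] := leqP n b.
  by rewrite -(subnKC nb) big_split_ord /= lerDl sumr_ge0.
by rewrite -(subnKC bn) big_split_ord /= [X in _ + X]big1 ?addr0 // => i _; rewrite fb ?leq_addr.
Qed.

Section DominatingTest.
Variables (R : realType) (P : bitstring -> R) (Ps : nat -> bitstring -> rat).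
Hypothesis hPs : approx_below code1 P Ps.
Variables (p : seq nat -> rat) (b : seq nat -> nat).
Hypotheses (rp : recrat 2 p) (pE : forall s x, Ps s x = p [:: s; strcode x]).
Hypotheses (rb : recfun 1 b)
  (Ps_support : forall s x, (b [:: s] <= strcode x)%N -> Ps s x = 0).
Variables (e : bitstring -> \bar R) (en ed : seq nat -> nat).
Hypotheses (hsum : sumtest P e) (ren : recfun 2 en) (red : recfun 2 ed).
Let E t x : \bar R := eratio (en [:: t; strcode x])%:R (ed [:: t; strcode x])%:R.
Hypotheses (E_le : forall t x, (E t.+1 x <= E t x)%E)
  (E_cvg : forall x, E t x @[t --> \oo] --> e x).

(* [test_mass [:: n; t; s]] is P_s(x) e_t(x) for the string [x] of rank [n],
   except that an infinite value is replaced by 3, which exceeds the bound 2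
   that the stage [t] is required to meet. *)
Definition test_mass (v : seq nat) : rat :=
  if p [:: nth 0 v 2; nth 0 v 0]%N <= 0 then 0
  else if ed [:: nth 0 v 1; nth 0 v 0]%N == 0%N then 3%:R
  else p [:: nth 0 v 2; nth 0 v 0]%N *
    ((en [:: nth 0 v 1; nth 0 v 0]%N)%:R / (ed [:: nth 0 v 1; nth 0 v 0]%N)%:R).

Lemma recrat_test_mass : recrat 3 test_mass.
Proof.
have rpv : recrat 3 (fun v => p [:: nth 0 v 2; nth 0 v 0]%N).
  by apply: recrat_comp2 => //; exact: recfun_nth.
have rv F : recfun 2 F -> recfun 3 (fun v => F [:: nth 0 v 1; nth 0 v 0]%N).
  by move=> rF; apply: recfun_comp2 => //; exact: recfun_nth.
apply: recrat_if.
- by apply: recfun_le => //; exact: (recrat_const _ 0).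
- exact: (recrat_const _ 0).
apply: recrat_if.
- by apply: recfun_eq0; exact: rv.
- exact: recrat_const.
apply: recrat_mul => //; apply: recrat_mul.
- by apply: recrat_nat; exact: rv.
- by apply: recrat_inv; apply: recrat_nat; exact: rv.
Qed.

Lemma p_ge0 s n : 0 <= p [:: s; n].
Proof. by rewrite -[n]strdecodeK -pE (approx_below_ge0 hPs). Qed.

Lemma test_mass_ge0 v : 0 <= test_mass v.
Proof.
rewrite /test_mass; case: ifP => // _; case: ifP => // _.
by apply: mulr_ge0; [exact: p_ge0|exact: divr_ge0].
Qed.

Lemma test_mass_support n t s : (b [:: s] <= n)%N -> test_mass [:: n; t; s] = 0.
Proof.
rewrite -[n]strdecodeK => /Ps_support; rewrite pE /test_mass /= => ->.
by rewrite lexx.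
Qed.

Lemma e_le_stage t x : (e x <= E t x)%E.
Proof.
apply: cvge_le (E_cvg (x := x)).
by exists t => // k /= tk; move/nonincreasing_seqP : (E_le^~ x); apply.
Qed.

Lemma partial_sum_test_le n : (\sum_(i < n) (P (strdecode i))%:E * e (strdecode i) <= 1)%E.
Proof.
have [e0 eP] := hsum.
move: n; apply/(@esum_strings_leP _ (fun x => (P x)%:E * e x)%E) => // x.
by apply: mule_ge0 => //; rewrite lee_fin (approx_below_lim_ge0 hPs).
Qed.

(** An infinite value at a point of positive mass would make a partial sum infinite, although all
    are at most 1. *)
Lemma test_lty x : 0 < P x -> (e x < +oo)%E.
Proof.
move=> Px; have [e0 _] := hsum; have := partial_sum_test_le (strcode x).+1.
rewrite big_ord_recr /= strcodeK; case: (e x) => [r _||]; first exact: ltry.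
  rewrite gt0_muley ?lte_fin // addey // gt_eqF // (lt_le_trans (ltNyr 0)) //.
  by apply: sume_ge0 => i _; apply: mule_ge0 => //; rewrite lee_fin (approx_below_lim_ge0 hPs).
by [].
Qed.

(** If [p [:: s; n]] is 0, both sides are 0. Otherwise [P] is positive at this string, so [e] is
    finite there; from some stage on the approximation is finite too, and the substitute value 3 no
    longer occurs. *)
Lemma test_mass_cvg n s :
  (ratr (test_mass [:: n; t; s]) : R)%:E @[t --> \oo] -->
  ((ratr (p [:: s; n]) : R)%:E * e (strdecode n))%E.
Proof.
have := p_ge0 s n; rewrite le_eqVlt => /predU1P[p0|p0].
  rewrite -p0 rmorph0 mul0e; under eq_fun => t.
    rewrite /test_mass /= -p0 lexx rmorph0; over.
  exact: cvg_cst.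
have Px0 : 0 < P (strdecode n).
  apply: lt_le_trans (approx_below_le hPs s _).
  by rewrite pE strdecodeK ltr0q.
have rp0 : (ratr (p [:: s; n]) : R)%:E \is a fin_num by [].
have E_eq : \forall t \near \oo, ((ratr (p [:: s; n]) : R)%:E * E t (strdecode n))%E =
    (ratr (test_mass [:: n; t; s]) : R)%:E.
  have E_lty : \forall t \near \oo, (E t (strdecode n) < +oo)%E.
    exact: E_cvg (open_ereal_lt' (test_lty Px0)).
  apply: filterS E_lty => t.
  rewrite /test_mass /= leNgt p0 /= /E strdecodeK /eratio pnatr_eq0.
  by case: ifP => // _ _; rewrite rmorphM fmorph_div !rmorph_nat EFinM.
by apply: cvg_trans (cvgeZl rp0 (E_cvg (x := strdecode n))); exact: near_eq_cvg E_eq.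
Qed.

(** The sums over the support converge to a limit at most 1, because [Ps s] lies below [P]; the gap
    between 1 and 2 lets a finite stage meet the bound. *)
Lemma test_stage_exists s :
  exists t, \sum_(i < b [:: s]) test_mass [:: val i; t; s] <= 2%:R.
Proof.
have S_cvg : (\sum_(i < b [:: s]) (ratr (test_mass [:: val i; t; s]) : R)%:E)%E
    @[t --> \oo] --> (\sum_(i < b [:: s]) (ratr (p [:: s; val i]) : R)%:E * e (strdecode i))%E.
  apply: cvg_nnesum => i _; last exact: test_mass_cvg.
  by apply: nearW => t; rewrite lee_fin ler0q test_mass_ge0.
have S_lt : (\sum_(i < b [:: s]) (ratr (p [:: s; val i]) : R)%:E * e (strdecode i) < 2%:E)%E.
  apply: (@le_lt_trans _ _ 1%E); last by rewrite lte_fin ltr1n.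
  apply: le_trans (partial_sum_test_le (b [:: s])); apply: lee_sum => i _.
  have [e0 _] := hsum; apply: lee_wpmul2r => //.
  by rewrite lee_fin -{1}[val i]strdecodeK -pE (approx_below_le hPs).
have /filter_ex[t] : \forall t \near \oo,
    (\sum_(i < b [:: s]) (ratr (test_mass [:: val i; t; s]) : R)%:E < 2%:E)%E.
  exact: S_cvg (open_ereal_lt' S_lt).
rewrite sumEFin lte_fin -rmorph_sum => /ltW.
by rewrite -(ratr_nat R 2) ler_rat; exists t.
Qed.

(** The condition on a stage is decidable, being a comparison of a finite rational sum of computable
    length with 2, so a suitable stage can be searched for. *)
Lemma test_stage : exists2 t, recfun 1 t &
  forall s, \sum_(i < b [:: s]) test_mass [:: val i; t [:: s]; s] <= 2%:R.
Proof.
have rsum : recfun 2 (fun v => \sum_(i < b [:: nth 0%N v 1])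
    test_mass [:: val i; nth 0 v 0; nth 0 v 1]%N <= 2%:R).
  apply: recfun_le; last exact: recrat_const.
  apply: (@recrat_sum 2 (fun w => test_mass [:: nth 0 w 0; nth 0 w 1; nth 0 w 2]%N)
    (fun v => b [:: nth 0%N v 1])).
  - by apply: recrat_comp3; [exact: recrat_test_mass|exact: recfun_nth..].
  - by apply: recfun_comp1 => //; exact: recfun_nth.
have [|t rt tP] := recfun_min rsum; first by move=> v; exact: test_stage_exists.
by exists t => // s; exact: (tP [:: s]).
Qed.

(** A single term of the sum is at most 2, hence is not the substitute 3 but the true product of
    [Ps s x] with the approximation of [e x] at stage [t], which is at least [e x]. *)
Lemma test_mass_bound t s x : 0 < Ps s x ->
  \sum_(i < b [:: s]) test_mass [:: val i; t; s] <= 2%:R ->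
  (e x <= (ratr (test_mass [:: strcode x; t; s] / Ps s x) : R)%:E)%E.
Proof.
move=> p0 sum_le2.
have xb : (strcode x < b [:: s])%N.
  by rewrite ltnNge; apply/negP => /Ps_support p00; rewrite p00 ltxx in p0.
have : test_mass [:: strcode x; t; s] <= 2%:R.
  apply: le_trans sum_le2; rewrite (bigD1 (Ordinal xb)) //= lerDl.
  by apply: sumr_ge0 => i _; exact: test_mass_ge0.
rewrite /test_mass /= -pE [Ps s x <= 0]leNgt p0 /=.
case: ifPn => [_|ed0 _]; first by rewrite ler_nat.
apply: le_trans (e_le_stage t x) _.
rewrite /E /eratio pnatr_eq0 (negPf ed0) mulrAC divff ?gt_eqF // mul1r.
by rewrite fmorph_div !rmorph_nat.
Qed.

End DominatingTest.

Lemma universal_dominates (R : realType) (m : bitstring * nat -> R)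
    (mt : nat -> bitstring * nat -> rat) (hm : universal m)
    (hmt : approx_below code2 m mt) (Q : seq nat -> rat) :
  recrat 2 Q -> (forall v, 0 <= Q v) ->
  (forall s n, \sum_(i < n) Q [:: val i; s] <= 1) ->
  exists c : nat, exists h : bitstring -> nat -> nat,
    [/\ (0 < c)%N, computable_family code1 (fun s x => h x s)
      & forall x s, Q [:: strcode x; s] <= c%:R * mt (h x s) (x, s)].
Proof.
move=> rQ Q_ge0 Q_le1; have [_ _ m_univ] := hm.
pose q (xs : bitstring * nat) : R := ratr (Q [:: strcode xs.1; xs.2]).
have q_semi : cond_semimeasure q.
  move=> s; have q_ge0 x : 0 <= q (x, s) by rewrite ler0q.
  split=> //; apply/esum_strings_leP => [x|n]; first by rewrite lee_fin.
  rewrite /q /= sumEFin -rmorph_sum lee_fin -[leRHS](ratr_nat R 1) ler_rat.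
  by under eq_bigr do rewrite strdecodeK; exact: Q_le1.
have q_lower : lower_semicomputable code2 q.
  (* [Q] is already rational and computable, so the constant approximation serves. *)
  exists (fun _ xs => Q [:: strcode xs.1; xs.2]); split=> [|//|x]; last exact: cvg_cst.
  apply/computable_nnrat_familyP; exists (fun v => Q [:: nth 0 v 1; nth 0 v 2]%N) => //.
  by apply: recrat_comp2 => //; exact: recfun_nth.
have [c c0 q_le] := m_univ q q_semi q_lower.
(* A natural constant keeps the later test within rational arithmetic. Being strictly larger than
   [c], it makes [q / K] strictly smaller than [m] wherever [Q] is positive, so some stage of [mt]
   already exceeds it. *)
pose K := Num.bound c; have c_lt : c < K%:R := archi_boundP (ltW c0).
have K_gt0 : (0 < K)%N by rewrite -(ltr_nat R) (lt_trans c0).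
have [/computable_nnrat_familyP[f rf mtE] _ _] := hmt.
have stage s x : exists t, Q [:: strcode x; s] <= K%:R * mt t (x, s).
  have := Q_ge0 [:: strcode x; s]; rewrite le_eqVlt => /predU1P[<-|Qp].
    by exists 0%N; rewrite mulr_ge0 // (approx_below_ge0 hmt).
  have q_lt : q (x, s) / K%:R < m (x, s).
    rewrite ltr_pdivrMr ?ltr0n // mulrC; apply: le_lt_trans (q_le x s) _.
    rewrite ltr_pM2r // -(pmulr_rgt0 _ c0); apply: lt_le_trans (q_le x s).
    by rewrite ltr0q.
  have [t] := approx_below_gt hmt q_lt.
  rewrite /q /= -(ratr_nat R K) -fmorph_div ltr_rat ltr_pdivrMr ?ltr0n // mulrC => /ltW.
  by exists t.
(* The arguments are the candidate stage, the condition [s] and the rank of [x]; the search runs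
   over the first. *)
have rc : recfun 3 (fun v => Q [:: nth 0 v 2; nth 0 v 1]%N <=
    K%:R * f [:: nth 0 v 0; nth 0 v 2; nth 0 v 1]%N).
  apply: recfun_le; first by apply: recrat_comp2 => //; exact: recfun_nth.
  apply: recrat_mul; first exact: recrat_const.
  by apply: recrat_comp3 => //; exact: recfun_nth.
have [v|h rh hP] := recfun_min rc.
  have [t] := stage (nth 0 v 0)%N (strdecode (nth 0 v 1)%N).
  by rewrite mtE /code2 /= strdecodeK; exists t.
exists K, (fun x s => h [:: s; strcode x]); split=> // [|x s].
  by apply/computable_familyP; exists h.
by rewrite mtE; exact: (hP [:: s; strcode x]).
Qed.

Unset Implicit Arguments.
Set Strict Implicit.

Theorem theorem1 (R : realType)
    (P : bitstring -> R) (Ps : nat -> bitstring -> rat)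
    (m : bitstring * nat -> R) (mt : nat -> bitstring * nat -> rat)
    (hP : semimeasure P) (hPs : approx_below code1 P Ps)
    (hm : universal m) (hmt : approx_below code2 m mt) :
  (forall h : bitstring -> nat -> nat,
     computable_family code1 (fun s x => h x s) ->
     upper_semicomputable (u_fun R Ps mt h) /\ sumtest P (u_fun R Ps mt h)) /\
  (computably_finite_support Ps ->
   forall e : bitstring -> \bar R,
     upper_semicomputable e -> sumtest P e ->
     exists c : R, exists h : bitstring -> nat -> nat,
       [/\ 0 < c, computable_family code1 (fun s x => h x s)
         & forall x, (e x <= c%:E * u_fun R Ps mt h x)%E]).
Proof.
have [m_semi _ _] := hm; split=> [h hh|].
  split; first exact: (u_fun_upper_semicomputable hPs hmt).
  exact: (u_fun_sumtest hPs hmt).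
move=> [b0 /recursive_recfun[b rb bE] Ps_supp] e.
move=> [num [den [/computable_familyP[en ren numE] /computable_familyP[ed red denE]]]].
move=> /= E_le E_cvg e_test.
have [/computable_nnrat_familyP[p rp pE] _ _] := hPs.
have {}E_le t x : (eratio ((en [:: t.+1; strcode x])%:R : R) (ed [:: t.+1; strcode x])%:R <=
    eratio ((en [:: t; strcode x])%:R : R) (ed [:: t; strcode x])%:R)%E.
  by have := E_le t x; rewrite !numE !denE.
have {}E_cvg x : eratio ((en [:: t; strcode x])%:R : R) (ed [:: t; strcode x])%:R
    @[t --> \oo] --> e x.
  by have := E_cvg x; under eq_fun do rewrite numE denE.
have {}Ps_supp s x : (b [:: s] <= strcode x)%N -> Ps s x = 0.
  by move=> bs; apply: Ps_supp; rewrite bE.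
have [t rt t_le2] := test_stage hPs rp pE rb e_test ren red E_cvg.
pose M := test_mass p en ed.
have M_ge0 v : 0 <= M v by exact: (test_mass_ge0 hPs pE).
(* The arguments are the rank of [x] and the condition [s]; halving turns the bound 2 on the chosen
   stage into the bound 1 of a semimeasure. *)
pose Q v := M [:: nth 0 v 0; t [:: nth 0 v 1]; nth 0 v 1]%N / 2%:R.
have rQ : recrat 2 Q.
  apply: recrat_mul; last by apply: recrat_inv; exact: recrat_const.
  apply: recrat_comp3; first exact: recrat_test_mass.
  - exact: recfun_nth.
  - by apply: recfun_comp1 => //; exact: recfun_nth.
  - exact: recfun_nth.
have Q_ge0 v : 0 <= Q v by rewrite divr_ge0.
have Q_le1 s n : \sum_(i < n) Q [:: val i; s] <= 1.
  rewrite -mulr_suml ler_pdivrMr // mul1r; apply: le_trans (t_le2 s).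
  (* Terms of rank at least [b [:: s]] vanish, so the bound at the chosen stage covers partial sums
     of every length. *)
  apply: (@ler_sum_support _ (fun i => M [:: i; t [:: s]; s])) => // i.
  exact: (test_mass_support pE Ps_supp).
have [c [h [c_gt0 rh h_le]]] := universal_dominates hm hmt rQ Q_ge0 Q_le1.
have c2_gt0 : 0 < (2 * c)%N%:R :> R by rewrite ltr0n muln_gt0.
(* The factor [c] comes from domination by [m], and 2 undoes the halving in [Q]. *)
exists (2 * c)%N%:R, h; split=> // x.
(* Dividing by the constant first allows the infimum to be bounded ratio by ratio; a ratio with
   [Ps s x = 0] is [+oo]. *)
rewrite -lee_pdivrMl //; apply/ereal_infP => _ [s _ <-].
have := approx_below_ge0 hPs s x; rewrite le_eqVlt => /predU1P[<-|Ps_gt0].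
  by rewrite /eratio rmorph0 eqxx leey.
rewrite /eratio fmorph_eq0 gt_eqF // lee_pdivrMl //.
apply: le_trans (test_mass_bound hPs pE Ps_supp E_le E_cvg Ps_gt0 (t_le2 s)) _.
rewrite -EFinM lee_fin -(ratr_nat R) -fmorph_div -rmorphM ler_rat mulrA.
rewrite ler_pM2r ?invr_gt0 // natrM -mulrA -ler_pdivrMl // mulrC.
exact: h_le.
Qed.
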